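(* Let $m,n,s,k$ be integers with $m+s\ge n\ge s\ge 0$ and $k\le n$. Let $A\in\mathbb{R}^{m\times n}$, $B\in\mathbb{R}^{s\times n}$, $b\in\mathbb{R}^m$, $d\in\mathbb{R}^s$ satisfy $\mathrm{rank}(B)=s$ and $\mathrm{null}(A)\cap\mathrm{null}(B)=\{0\}$, let $L\in\mathbb{R}^{n\times k}$, and let $\alpha_A,\alpha_B,\alpha_b,\alpha_d>0$. Let $x=x(A,B,b,d)$ be the unique solution of $\min_{Bx=d}\|b-Ax\|_2$ and $r=b-Ax$. Then the partial condition number with respect to $L$ (defined in the context) satisfies $$\kappa_{LSE}(A,B,b,d)=\|C\|_2^{1/2},$$ where $$\begin{aligned}C={}&\left(\frac{\|r\|_2^2}{\alpha_A^2}+\frac{\|r^TAB_A^\dagger\|_2^2}{\alpha_B^2}\right)L^T\left(((AP)^TAP)^\dagger\right)^2L+\left(\frac{\|x\|_2^2}{\alpha_A^2}+\frac1{\alpha_b^2}\right)L^T((AP)^TAP)^\dagger L\\&+\left(\frac{\|x\|_2^2}{\alpha_B^2}+\frac1{\alpha_d^2}\right)L^TB_A^\dagger(B_A^\dagger)^TL+\frac1{\alpha_B^2}L^T((AP)^TAP)^\dagger x r^TAB_A^\dagger(B_A^\dagger)^TL\\&+\frac1{\alpha_B^2}L^TB_A^\dagger(B_A^\dagger)^TA^Trx^T((AP)^TAP)^\dagger L.\end{aligned}$$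
   Context: For a matrix $C$, $C^\dagger$ is the Moore-Penrose inverse, $\|C\|_2$ the spectral norm and $\|C\|_F$ the Frobenius norm. $P=I_n-B^\dagger B$ and $B_A^\dagger=(I_n-(AP)^\dagger A)B^\dagger$. Under the rank conditions $\mathrm{rank}(B)=s$, $\mathrm{null}(A)\cap\mathrm{null}(B)=\{0\}$, the problem $\min_{Bx=d}\|b-Ax\|_2$ has the unique solution $x(A,B,b,d)=(AP)^\dagger b+B_A^\dagger d$. Define $g(A,B,b,d)=L^Tx(A,B,b,d)\in\mathbb{R}^k$; $g$ is continuously Fréchet differentiable in a neighborhood of $(A,B,b,d)$ in $\mathbb{R}^{m\times n}\times\mathbb{R}^{s\times n}\times\mathbb{R}^m\times\mathbb{R}^s$, and $g'(A,B,b,d)$ denotes its Fréchet derivative (a linear map) there. The weighted Frobenius norm is $$\|(\alpha_A\Delta A,\alpha_B\Delta B,\alpha_b\Delta b,\alpha_d\Delta d)\|_F=\sqrt{\alpha_A^2\|\Delta A\|_F^2+\alpha_B^2\|\Delta B\|_F^2+\alpha_b^2\|\Delta b\|_2^2+\alpha_d^2\|\Delta d\|_2^2}.$$ The partial condition number with respect to $L$ is $$\kappa_{LSE}(A,B,b,d)=\max_{(\Delta A,\Delta B,\Delta b,\Delta d)\ne0}\frac{\|g'(A,B,b,d)(\Delta A,\Delta B,\Delta b,\Delta d)\|_2}{\|(\alpha_A\Delta A,\alpha_B\Delta B,\alpha_b\Delta b,\alpha_d\Delta d)\|_F},$$ the maximum being over all $\Delta A\in\mathbb{R}^{m\times n}$,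 $\Delta B\in\mathbb{R}^{s\times n}$, $\Delta b\in\mathbb{R}^m$, $\Delta d\in\mathbb{R}^s$ not all zero. *)

(* Defs.v *)
From HB Require Import structures.
From mathcomp Require Import all_boot all_order all_algebra.
From mathcomp Require Import all_classical all_reals all_analysis.

Set Implicit Arguments.
Unset Strict Implicit.
Unset Printing Implicit Defensive.
Import Order.TTheory GRing.Theory Num.Theory.
Import numFieldNormedType.Exports.

Local Open Scope classical_set_scope.
Local Open Scope ring_scope.

(* On row and column vectors this is the Euclidean norm; the library norm
   `|A| on matrices is the max norm. *)
Definition normF (R : realType) (m n : nat) (A : 'M[R]_(m, n)) : R :=
  Num.sqrt (\sum_i \sum_j A i j ^+ 2).

(* The ball, rather than the sphere, keeps the set nonempty when n = 0. *)
Definition spectral_norm (R : realType) (m n : nat) (A : 'M[R]_(m, n)) : R :=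
  sup [set normF (A *m v) | v in [set v : 'cV[R]_n | normF v <= 1]].

Definition is_mpinv (R : realType) (m n : nat)
    (A : 'M[R]_(m, n)) (X : 'M[R]_(n, m)) : Prop :=
  [/\ A *m X *m A = A, X *m A *m X = X,
      (A *m X)^T = A *m X & (X *m A)^T = X *m A].

(* The Penrose equations have exactly one solution, so the default 0 of xget
   is never used. *)
Definition mpinv (R : realType) (m n : nat) (A : 'M[R]_(m, n)) : 'M[R]_(n, m) :=
  xget 0 [set X | is_mpinv A X].

Definition kerproj (R : realType) (s n : nat) (B : 'M[R]_(s, n)) : 'M[R]_n :=
  1%:M - mpinv B *m B.

(* The weighted inverse $B_A^\dagger$. *)
Definition wpinv (R : realType) (m n s : nat)
    (A : 'M[R]_(m, n)) (B : 'M[R]_(s, n)) : 'M[R]_(n, s) :=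
  (1%:M - mpinv (A *m kerproj B) *m A) *m mpinv B.

Definition is_lse_solution (R : realType) (m n s : nat) (A : 'M[R]_(m, n))
    (B : 'M[R]_(s, n)) (b : 'cV[R]_m) (d : 'cV[R]_s) (x : 'cV[R]_n) : Prop :=
  B *m x = d /\
  forall y : 'cV[R]_n, B *m y = d -> normF (b - A *m x) <= normF (b - A *m y).

(* Under the rank conditions, which are open in (A, B), the solution exists and
   is unique, and equals mpinv (A *m kerproj B) *m b + wpinv A B *m d. *)
Definition lse_sol (R : realType) (m n s : nat) (A : 'M[R]_(m, n))
    (B : 'M[R]_(s, n)) (b : 'cV[R]_m) (d : 'cV[R]_s) : 'cV[R]_n :=
  xget 0 [set x | is_lse_solution A B b d x].

Definition lse_map (R : realType) (m n s k : nat) (L : 'M[R]_(n, k))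
    (p : 'M[R]_(m, n) * 'M[R]_(s, n) * 'cV[R]_m * 'cV[R]_s) : 'cV[R]_k :=
  let: (A, B, b, d) := p in L^T *m lse_sol A B b d.

Definition weighted_normF (R : realType) (m n s : nat) (aA aB ab ad : R)
    (p : 'M[R]_(m, n) * 'M[R]_(s, n) * 'cV[R]_m * 'cV[R]_s) : R :=
  let: (dA, dB, db, dd) := p in
  Num.sqrt (aA ^+ 2 * normF dA ^+ 2 + aB ^+ 2 * normF dB ^+ 2 +
            ab ^+ 2 * normF db ^+ 2 + ad ^+ 2 * normF dd ^+ 2).

(* The maximum, not the supremum, of S; it is 0 when S has no maximum, in
   particular when S is empty. *)
Definition maximum (R : realType) (S : set R) : R :=
  xget 0 [set v | S v /\ ubound S v].

(* All norms on the finite-dimensional space of data are equivalent, so the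
   Fréchet derivative 'd does not depend on the library's choice of norm. When
   m = s = 0 the data space is trivial, there is no nonzero perturbation, and
   the value is 0. *)
Definition kappa_lse (R : realType) (m n s k : nat) (L : 'M[R]_(n, k))
    (aA aB ab ad : R) (A : 'M[R]_(m, n)) (B : 'M[R]_(s, n))
    (b : 'cV[R]_m) (d : 'cV[R]_s) : R :=
  maximum [set normF ('d (@lse_map R m n s k L) (A, B, b, d) p)
               / weighted_normF aA aB ab ad p
          | p in [set p : 'M[R]_(m, n) * 'M[R]_(s, n) * 'cV[R]_m * 'cV[R]_s
                 | p != 0]].

(* Main.v *)
Require Import Defs.
From HB Require Import structures.
From mathcomp Require Import all_boot all_order all_algebra.
From mathcomp Require Import all_classical all_reals all_analysis.
From mathcomp Require Import ring lra.
Import Order.TTheory GRing.Theory Num.Theory.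
Import numFieldNormedType.Exports.
Local Open Scope ring_scope.
Set Implicit Arguments.
Unset Strict Implicit.
Unset Printing Implicit Defensive.

(* The residual r, a multiplier l and the solution x solve a square linear system
   that is affine in the data (A, B, b, d).  Perturbing this system shows that the
   solution map is differentiable, with
     dx = G (A^T (db - dA x) + dA^T r + dB^T l) + BA (dd - dB x),
   where G = ((AP)^T AP)^+, BA = B_A^+ and l = - BA^T A^T r.  For the weighted
   Frobenius inner product, the map T = g' and its adjoint T^* satisfy T T^* = C;
   the cross terms coming from dA vanish because G A^T r = 0.  Hence kappa^2, the
   maximum of ||T p||^2 / ||p||^2, is ||T T^*||_2 = ||C||_2, and it is attained at
   p = T^* v for a v of norm at most 1 maximising ||C v||. *)

(** * Inner products and Moore-Penrose inverses *)

(** Stated for an abstract positive semidefinite form so that it serves both [frob] and the weighted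
    product on the data space. The reason is that the quadratic [a |-> ip (a v + u) (a v + u)] is
    never negative. *)
Lemma cauchy_schwarz (R : realFieldType) (V : lmodType R) (ip : V -> V -> R) :
  (forall a u v w, ip (a *: u + v) w = a * ip u w + ip v w) ->
  (forall u v, ip u v = ip v u) -> (forall u, 0 <= ip u u) ->
  forall u v, ip u v ^+ 2 <= ip u u * ip v v.
Proof.
move=> lin sym pos u v.
have expand a : ip (a *: v + u) (a *: v + u) =
    a ^+ 2 * ip v v + 2 * a * ip u v + ip u u.
  rewrite lin (sym v) (sym u) !lin (sym v u); ring.
have [v0|v0] := eqVneq (ip v v) 0.
  rewrite v0 mulr0; have [->|uv0] := eqVneq (ip u v) 0; first by rewrite expr0n.
  (* With [ip v v = 0] the quadratic is affine in [a]; this [a] would give it the value -1. *)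
  have := pos (- (ip u u + 1) / (2 * ip u v) *: v + u); rewrite expand v0.
  have -> : 2 * (- (ip u u + 1) / (2 * ip u v)) * ip u v = - (ip u u + 1).
    by field.
  by move=> h; exfalso; lra.
have vp : 0 < ip v v by rewrite lt_neqAle eq_sym v0 pos.
have := pos (- (ip u v / ip v v) *: v + u); rewrite expand.
have -> : (- (ip u v / ip v v)) ^+ 2 * ip v v + 2 * - (ip u v / ip v v) * ip u v
    + ip u u = (ip u u * ip v v - ip u v ^+ 2) / ip v v by field.
by rewrite pmulr_lge0 ?invr_gt0// subr_ge0.
Qed.

Section Frobenius.
Variable R : realType.

Definition frob m n (X Y : 'M[R]_(m, n)) : R := \tr (X^T *m Y).

Lemma frobE m n (X Y : 'M[R]_(m, n)) : frob X Y = \sum_i \sum_j X i j * Y i j.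
Proof.
rewrite /frob /mxtrace exchange_big; apply: eq_bigr => j _.
by rewrite mxE; apply: eq_bigr => i _; rewrite mxE.
Qed.

Lemma frobC m n (X Y : 'M[R]_(m, n)) : frob X Y = frob Y X.
Proof. by rewrite /frob -mxtrace_tr trmx_mul trmxK. Qed.

Lemma frob_linl m n a (X Y Z : 'M[R]_(m, n)) :
  frob (a *: X + Y) Z = a * frob X Z + frob Y Z.
Proof. by rewrite /frob linearP /= mulmxDl -scalemxAl linearP. Qed.

Lemma frobDl m n (X Y Z : 'M[R]_(m, n)) : frob (X + Y) Z = frob X Z + frob Y Z.
Proof. by rewrite -{1}[X]scale1r frob_linl mul1r. Qed.

Lemma frobNl m n (X Z : 'M[R]_(m, n)) : frob (- X) Z = - frob X Z.
Proof. by rewrite /frob raddfN /= mulNmx raddfN. Qed.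

Lemma frobDr m n (X Y Z : 'M[R]_(m, n)) : frob Z (X + Y) = frob Z X + frob Z Y.
Proof. by rewrite frobC frobDl !(frobC _ Z). Qed.

Lemma frobNr m n (X Z : 'M[R]_(m, n)) : frob Z (- X) = - frob Z X.
Proof. by rewrite frobC frobNl frobC. Qed.

Lemma frobZr m n a (X Z : 'M[R]_(m, n)) : frob Z (a *: X) = a * frob Z X.
Proof. by rewrite /frob -scalemxAr linearZ. Qed.

Lemma frob_mull m n p (M : 'M[R]_(m, n)) (X : 'M[R]_(n, p)) Y :
  frob (M *m X) Y = frob X (M^T *m Y).
Proof. by rewrite /frob trmx_mul mulmxA. Qed.

Lemma frob_mulr m n p (M : 'M[R]_(n, p)) (X : 'M[R]_(m, n)) Y :
  frob (X *m M) Y = frob X (Y *m M^T).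
Proof. by rewrite /frob trmx_mul -mulmxA mxtrace_mulC mulmxA. Qed.

Lemma frob_tr m n (X : 'M[R]_(m, n)) Y : frob X^T Y = frob X Y^T.
Proof. by rewrite /frob -mxtrace_tr trmx_mul trmxK mxtrace_mulC. Qed.

Lemma frob_ge0 m n (X : 'M[R]_(m, n)) : 0 <= frob X X.
Proof.
rewrite frobE; apply: sumr_ge0 => i _; apply: sumr_ge0 => j _.
by rewrite -expr2 sqr_ge0.
Qed.

Lemma frob_eq0 m n (X : 'M[R]_(m, n)) : frob X X = 0 -> X = 0.
Proof.
rewrite frobE => /eqP; rewrite psumr_eq0 => [/allP h|i _]; last first.
  by apply: sumr_ge0 => j _; rewrite -expr2 sqr_ge0.
apply/matrixP => i j; have := h i (mem_index_enum _).
rewrite psumr_eq0 => [/allP /(_ j (mem_index_enum _))|k _].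
  by rewrite -expr2 sqrf_eq0 mxE => /eqP.
by rewrite -expr2 sqr_ge0.
Qed.

Lemma normFE m n (X : 'M[R]_(m, n)) : normF X = Num.sqrt (frob X X).
Proof.
by rewrite /normF frobE; under eq_bigr do under eq_bigr do rewrite expr2.
Qed.

Lemma normF_sqr m n (X : 'M[R]_(m, n)) : normF X ^+ 2 = frob X X.
Proof. by rewrite normFE sqr_sqrtr// frob_ge0. Qed.

Lemma normF_ge0 m n (X : 'M[R]_(m, n)) : 0 <= normF X.
Proof. exact: sqrtr_ge0. Qed.

Lemma frob_le_normF m n (X Y : 'M[R]_(m, n)) : frob X Y <= normF X * normF Y.
Proof.
apply: le_trans (ler_norm _) _.
rewrite -sqrtr_sqr !normFE -sqrtrM ?frob_ge0// ler_sqrt ?mulr_ge0 ?frob_ge0//.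
by apply: (cauchy_schwarz (@frob_linl m n) (@frobC m n)) => u; exact: frob_ge0.
Qed.

Lemma normFZ m n a (X : 'M[R]_(m, n)) : normF (a *: X) = `|a| * normF X.
Proof.
rewrite !normFE frobZr (frobC _ X) frobZr mulrA -expr2 sqrtrM ?sqr_ge0//.
by rewrite sqrtr_sqr.
Qed.

Lemma normF0 m n : normF (0 : 'M[R]_(m, n)) = 0.
Proof. by rewrite -(scale0r 0) normFZ normr0 mul0r. Qed.

Lemma normF0_eq0 m n (X : 'M[R]_(m, n)) : normF X = 0 -> X = 0.
Proof.
by move=> X0; apply: frob_eq0; rewrite -normF_sqr X0 expr0n.
Qed.

Lemma gram_eq0 m n p (M : 'M[R]_(m, n)) (X : 'M[R]_(n, p)) :
  M^T *m M *m X = 0 -> M *m X = 0.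
Proof.
move=> MMX; apply: frob_eq0.
by rewrite frob_mull mulmxA MMX /frob mulmx0 mxtrace0.
Qed.

Lemma gram_unit n r (C : 'M[R]_(n, r)) :
  \rank C = r -> C^T *m C \in unitmx.
Proof.
move=> rC; rewrite -row_free_unit -kermx_eq0; apply/eqP.
have : C *m (kermx (C^T *m C))^T = 0.
  apply: gram_eq0; apply: trmx_inj; rewrite trmx_mul trmxK trmx_mul trmxK trmx0.
  exact: mulmx_ker.
move/(congr1 trmx); rewrite trmx_mul trmxK trmx0 => h; apply/eqP.
rewrite -(@mulmx_free_eq0 _ _ _ _ _ C^T) ?h//.
by rewrite /row_free mxrank_tr rC.
Qed.

End Frobenius.

(** * Existence, uniqueness and Gram form of the Moore-Penrose inverse *)

Section MoorePenrose.
Variable R : realType.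

(** [A X] and [A Y] are both the orthogonal projector onto the range of [A], hence equal; likewise
    [X A = Y A]. Then X = X A X = Y A X = Y A Y = Y. *)
Lemma is_mpinv_unique m n (A : 'M[R]_(m, n)) X Y :
  is_mpinv A X -> is_mpinv A Y -> X = Y.
Proof.
move=> [AXA XAX AX XA] [AYA YAY AY YA].
have eAX : A *m X = A *m Y.
  have : (A *m Y) *m (A *m X) = A *m X by rewrite mulmxA AYA.
  move/(congr1 trmx); rewrite trmx_mul AX AY => <-.
  by rewrite mulmxA AXA.
have eXA : X *m A = Y *m A.
  have : (X *m A) *m (Y *m A) = X *m A by rewrite -mulmxA (mulmxA A) AYA.
  move/(congr1 trmx); rewrite trmx_mul XA YA => <-.
  by rewrite -mulmxA (mulmxA A) AXA.
by rewrite -XAX eXA -mulmxA eAX mulmxA YAY.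
Qed.

(** Full-rank factorization: both Gram matrices are invertible and cancel in the Penrose equations.
    With the column and row bases of a matrix this yields existence. *)
Lemma is_mpinv_factor m n r (C : 'M[R]_(m, r)) (W : 'M[R]_(r, n)) :
  \rank C = r -> \rank W = r ->
  is_mpinv (C *m W) (W^T *m invmx (W *m W^T) *m (invmx (C^T *m C) *m C^T)).
Proof.
move=> rC rW; have uC : C^T *m C \in unitmx by exact: gram_unit.
have uW : W *m W^T \in unitmx.
  by rewrite -{1}[W]trmxK; apply: gram_unit; rewrite mxrank_tr.
set D := invmx (C^T *m C); set E := invmx (W *m W^T).
have DT : D^T = D by rewrite trmx_inv trmx_mul trmxK.
have ET : E^T = E by rewrite trmx_inv trmx_mul trmxK.
have AX : C *m W *m (W^T *m E *m (D *m C^T)) = C *m D *m C^T.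
  by rewrite -!mulmxA (mulmxA W) (mulmxA (W *m W^T)) mulmxV// mul1mx.
have XA : W^T *m E *m (D *m C^T) *m (C *m W) = W^T *m E *m W.
  by rewrite -!mulmxA (mulmxA C^T) (mulmxA D) mulVmx// mul1mx.
split.
- by rewrite AX -!mulmxA (mulmxA C^T) (mulmxA D) mulVmx// mul1mx.
- by rewrite XA -!mulmxA (mulmxA W) (mulmxA (W *m W^T)) mulmxV// mul1mx.
- by rewrite AX !trmx_mul trmxK DT mulmxA.
- by rewrite XA !trmx_mul trmxK ET mulmxA.
Qed.

Lemma is_mpinv_exists m n (A : 'M[R]_(m, n)) : exists X, is_mpinv A X.
Proof.
have /eqP rC : row_full (col_base A) by exact: col_base_full.
have /eqP rW : row_free (row_base A) by exact: row_base_free.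
have := is_mpinv_factor rC rW; rewrite mulmx_base => AX.
by eexists; exact: AX.
Qed.

Lemma mpinvP m n (A : 'M[R]_(m, n)) : is_mpinv A (mpinv A).
Proof.
by have [X AX] := is_mpinv_exists A; exact: (xgetPex _ (ex_intro _ X AX)).
Qed.

Lemma mpinv_eq m n (A : 'M[R]_(m, n)) X : is_mpinv A X -> mpinv A = X.
Proof. exact/is_mpinv_unique/mpinvP. Qed.

Lemma mpinv_tr m n (A : 'M[R]_(m, n)) : mpinv A^T = (mpinv A)^T.
Proof.
have [a b c d] := mpinvP A; apply: mpinv_eq; split.
- by rewrite -!trmx_mul mulmxA a.
- by rewrite -!trmx_mul mulmxA b.
- by rewrite -trmx_mul d.
- by rewrite -trmx_mul c.
Qed.

(** Lets [(AP)^+] inside [wpinv] be expressed through [G]. The key identity M G S = M is S G S = S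
    with the factor [M^T] cancelled by [gram_eq0]. *)
Lemma mpinv_gram m n (M : 'M[R]_(m, n)) :
  mpinv M = mpinv (M^T *m M) *m M^T.
Proof.
apply: mpinv_eq; set S := M^T *m M; set G := mpinv S.
have [a b c d] := mpinvP S; rewrite -/G in a b c d.
have GT : G^T = G by rewrite /G -mpinv_tr trmx_mul trmxK.
have MGS : M *m G *m S = M.
  apply/eqP; rewrite -subr_eq0 -{2}[M]mulmx1 -mulmxA -mulmxBr; apply/eqP.
  by apply: gram_eq0; rewrite mulmxBr mulmx1 mulmxA a subrr.
split.
- by rewrite -!mulmxA -/S mulmxA MGS.
- by rewrite -(mulmxA G) -/S mulmxA b.
- by rewrite !trmx_mul trmxK GT mulmxA.
- by rewrite -(mulmxA G) -/S d.
Qed.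

Lemma mpinv_row_free s n (B : 'M[R]_(s, n)) :
  \rank B = s -> B *m mpinv B = 1%:M.
Proof.
move=> rB; have [a b c d] := mpinvP B.
have fB : row_free B by rewrite /row_free rB.
by apply: (row_free_inj fB); rewrite a mul1mx.
Qed.

End MoorePenrose.

(** * The projected Gram matrix and the weighted inverse under the rank conditions *)

Section Constrained.
Variables (R : realType) (m n s : nat).
Variables (A : 'M[R]_(m, n)) (B : 'M[R]_(s, n)).
Hypothesis hB : \rank B = s.
Hypothesis hAB : forall v : 'cV[R]_n, A *m v = 0 -> B *m v = 0 -> v = 0.

Let P := kerproj B.
Let S := (A *m P)^T *m (A *m P).
Let G := mpinv S.
Let BA := wpinv A B.

Lemma kerproj_tr : P^T = P.
Proof.
have [_ _ _ d] := mpinvP B.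
by rewrite /P /kerproj linearB /= trmx1 d.
Qed.

Lemma mul_kerproj : B *m P = 0.
Proof.
by rewrite /P /kerproj mulmxBr mulmx1 mulmxA mpinv_row_free// mul1mx subrr.
Qed.

Lemma kerproj_idem : P *m P = P.
Proof.
by rewrite {1}/P /kerproj mulmxBl mul1mx -mulmxA mul_kerproj mulmx0 subr0.
Qed.

Lemma projgram_tr : G^T = G.
Proof. by rewrite /G -mpinv_tr /S !trmx_mul !trmxK. Qed.

Lemma projgramE : S = P *m A^T *m A *m P.
Proof. by rewrite /S trmx_mul kerproj_tr !mulmxA. Qed.

(** [S] and [G] are symmetric and commute, so G = S G G, and the range of [S] lies in that of
    [P]. *)
Lemma kerproj_projgram : P *m G = G.
Proof.
have [a b c d] := mpinvP S; rewrite -/G in a b c d.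
have ST : S^T = S by rewrite /S trmx_mul trmxK.
have SG : S *m G = G *m S by rewrite -c trmx_mul projgram_tr ST.
have GE : G = S *m (G *m G) by rewrite mulmxA SG b.
have PS : P *m S = S by rewrite projgramE !mulmxA kerproj_idem.
by rewrite GE mulmxA PS.
Qed.

Lemma projgram_kerproj : G *m P = G.
Proof.
by apply: trmx_inj; rewrite trmx_mul kerproj_tr projgram_tr kerproj_projgram.
Qed.

Lemma mul_projgram : B *m G = 0.
Proof. by rewrite -kerproj_projgram mulmxA mul_kerproj mul0mx. Qed.

Lemma projgram_gram : G *m A^T *m A *m G = G.
Proof.
have [_ b _ _] := mpinvP S; rewrite -/G in b.
by rewrite -{3}b projgramE !mulmxA projgram_kerproj -!mulmxA kerproj_projgram.
Qed.

(** [G] inverts the form [A^T A] on null(B). The defect W = P - G S is killed by both [A] and [B],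
    so null(A) and null(B) meeting trivially forces each of its columns to vanish. *)
Lemma projgram_inv : G *m A^T *m A *m P = P.
Proof.
have [a b c d] := mpinvP S; rewrite -/G in a b c d.
have GS : G *m A^T *m A *m P = G *m S.
  by rewrite projgramE !mulmxA projgram_kerproj.
have ST : S^T = S by rewrite /S trmx_mul trmxK.
rewrite GS; set W := P - G *m S.
have PW : P *m W = W.
  by rewrite /W mulmxBr kerproj_idem mulmxA kerproj_projgram.
have SP : S *m P = S by rewrite projgramE -!mulmxA kerproj_idem.
have SW : S *m W = 0 by rewrite /W mulmxBr SP mulmxA a subrr.
have AW : A *m W = 0 by rewrite -PW mulmxA; exact: gram_eq0.
have BW : B *m W = 0 by rewrite -PW mulmxA mul_kerproj mul0mx.
apply/eqP; rewrite eq_sym -subr_eq0 -/W; apply/eqP.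
apply/trmx_inj/row_matrixP => j; rewrite trmx0 row0.
apply: trmx_inj; rewrite trmx0 -tr_col trmxK.
by apply: hAB; rewrite colE mulmxA ?AW ?BW mul0mx.
Qed.

Lemma wpinvE : BA = mpinv B - G *m A^T *m A *m mpinv B.
Proof.
rewrite /BA /wpinv -/P mpinv_gram -/S -/G trmx_mul kerproj_tr mulmxA.
by rewrite projgram_kerproj mulmxBl mul1mx.
Qed.

Lemma mul_wpinv : B *m BA = 1%:M.
Proof.
by rewrite wpinvE mulmxBr !mulmxA mul_projgram !mul0mx subr0 mpinv_row_free.
Qed.

(** Optimality of [BA] for a zero right-hand side [b]: the gradient is orthogonal to null(B). It
    follows from the transpose of [projgram_inv]. *)
Lemma kerproj_gram_wpinv : P *m A^T *m A *m BA = 0.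
Proof.
rewrite wpinvE mulmxBr !mulmxA.
have := congr1 trmx projgram_inv; rewrite !trmx_mul !trmxK kerproj_tr projgram_tr.
by rewrite !mulmxA => ->; rewrite subrr.
Qed.

(** I - P = B^+ B is symmetric, so null(P) is the range of [B^T]; the explicit preimage will be a
    Lagrange multiplier. *)
Lemma kerproj_eq0 p (X : 'M[R]_(n, p)) :
  P *m X = 0 -> X = B^T *m ((mpinv B)^T *m X).
Proof.
move=> PX; have [_ _ _ d] := mpinvP B.
by rewrite mulmxA -trmx_mul d; apply/eqP; rewrite -subr_eq0 -{1}[X]mul1mx -mulmxBl PX.
Qed.

End Constrained.

(** * Perturbation of linear systems *)

Section MaxNorm.
Variable R : realType.

Lemma mx_norm_entry m n (X : 'M[R]_(m, n)) i j : `|X i j| <= `|X|.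
Proof.
rewrite [leRHS]/Num.norm /= mx_normrE.
by apply/bigmax_geP; right; exists (i, j).
Qed.

Lemma mx_norm_le m n (X : 'M[R]_(m, n)) c :
  0 <= c -> (forall i j, `|X i j| <= c) -> `|X| <= c.
Proof.
move=> c0 Xc; rewrite [leLHS]/Num.norm /= mx_normrE.
by apply/bigmax_leP; split => // -[i j] _; exact: Xc.
Qed.

Lemma mx_norm_mul m n p (X : 'M[R]_(m, n)) (Y : 'M[R]_(n, p)) :
  `|X *m Y| <= n%:R * `|X| * `|Y|.
Proof.
apply: mx_norm_le => [|i j]; first by rewrite !mulr_ge0.
rewrite mxE (le_trans (ler_norm_sum _ _ _))//.
rewrite -mulrA mulr_natl -[X in _ *+ X]card_ord -sumr_const.
by apply: ler_sum => k _; rewrite normrM ler_pM// mx_norm_entry.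
Qed.

Lemma mx_norm_col m1 m2 n (X : 'M[R]_(m1, n)) (Y : 'M[R]_(m2, n)) c :
  `|X| <= c -> `|Y| <= c -> `|col_mx X Y| <= c.
Proof.
move=> Xc Yc; apply: mx_norm_le => [|i j]; first exact: le_trans Xc.
rewrite mxE; case: (fintype.split i) => k.
  exact: le_trans (mx_norm_entry _ _ _) Xc.
exact: le_trans (mx_norm_entry _ _ _) Yc.
Qed.

Lemma mx_norm_row m n1 n2 (X : 'M[R]_(m, n1)) (Y : 'M[R]_(m, n2)) c :
  `|X| <= c -> `|Y| <= c -> `|row_mx X Y| <= c.
Proof.
move=> Xc Yc; apply: mx_norm_le => [|i j]; first exact: le_trans Xc.
rewrite mxE; case: (fintype.split j) => k.
  exact: le_trans (mx_norm_entry _ _ _) Xc.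
exact: le_trans (mx_norm_entry _ _ _) Yc.
Qed.

Lemma mx_norm_dsub m1 m2 n (X : 'M[R]_(m1 + m2, n)) : `|dsubmx X| <= `|X|.
Proof. by apply: mx_norm_le => // i j; rewrite mxE mx_norm_entry. Qed.

Lemma mx_norm_tr m n (X : 'M[R]_(m, n)) : `|X^T| <= `|X|.
Proof. by apply: mx_norm_le => // i j; rewrite mxE mx_norm_entry. Qed.

Lemma inj_unitmx n (M : 'M[R]_n) :
  (forall v : 'cV_n, M *m v = 0 -> v = 0) -> M \in unitmx.
Proof.
move=> injM; rewrite -unitmx_tr -row_free_unit -kermx_eq0; apply/eqP.
apply/row_matrixP => i; rewrite row0; apply: trmx_inj; rewrite trmx0.
apply: injM; apply: trmx_inj; rewrite trmx_mul trmxK -row_mul mulmx_ker row0.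
by rewrite trmx0.
Qed.

End MaxNorm.

(** A quadratic remainder is o(p), and boundedness makes the linear map continuous, so uniqueness of
    the first-order expansion applies. [C] may have any sign, whence the bound by [|C| + 1]
    inside. *)
Lemma diff_quadratic_remainder (R : realType) (V W : normedModType R)
    (f df : V -> W) (x : V) (c C e : R) :
  linear df -> (forall p, `|df p| <= c * `|p|) -> 0 < e ->
  (forall p, `|p| < e -> `|f (p + x) - f x - df p| <= C * `|p| ^+ 2) ->
  'd f x = df :> (V -> W).
Proof.
move=> ldf bdf e0 rem.
pose dfL : {linear V -> W} :=
  HB.pack df (GRing.isLinear.Build R V W *:%R df ldf).
have cdf : continuous dfL.
  apply: bounded_linear_continuous; apply/linear_boundedP.
  exists c; split=> [|y cy p]; first exact: num_real.
  by apply: le_trans (bdf p) _; rewrite ler_wpM2r// ltW.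
rewrite -[RHS]/(dfL : V -> W); apply: diff_unique => //.
have C1 : 0 < `|C| + 1 by rewrite ltr_wpDl.
apply/eqaddoP => _/posnumP[eps]; near=> p.
have -> : (f \o shift x - (cst (f x) + dfL)) p = f (p + x) - f x - df p.
  by rewrite /GRing.add /GRing.opp /= opprD addrA.
have pe : `|p| < e.
  by near: p; apply: nbhs0_lt.
have pC : (`|C| + 1) * `|p| < eps%:num.
  rewrite mulrC -(ltr_pdivlMr _ _ C1).
  by near: p; apply: nbhs0_lt; rewrite divr_gt0.
apply: le_trans (rem p pe) _; rewrite expr2 mulrA ler_wpM2r//.
apply: le_trans (ltW pC); rewrite ler_wpM2r//.
by rewrite (le_trans (ler_norm _))// lerDl.
Unshelve. all: by end_near. Qed.

(** * First-order expansion of the solution when matrix and right-hand side are perturbed *)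

Section Perturbation.
Variables (R : realType) (V : normedModType R) (N : nat).
Variables (K0 K0i : 'M[R]_N) (c0 z0 : 'cV[R]_N).
Variables (E : V -> 'M[R]_N) (c : V -> 'cV[R]_N).
Hypotheses (K0iK : K0i *m K0 = 1%:M) (Kz0 : K0 *m z0 = c0).
Hypotheses (bE : forall p, `|E p| <= `|p|) (bc : forall p, `|c p| <= `|p|).

(** The max norm is submultiplicative only up to the inner dimension, hence the factors [N]. [a]
    bounds the action of [K0i], [t |p|] that of [K0i E(p)], and [b |p|] the vector c(p) - E(p) z0.
    The radius [e] ensures t |p| <= 1/2, the [+ 1] covering t = 0. *)
Let a : R := N%:R * `|K0i|.
Let t : R := a * N%:R.
Let b : R := 1 + N%:R * `|z0|.
Let e : R := (2 * (t + 1))^-1.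

Let a0 : 0 <= a. Proof. by rewrite mulr_ge0. Qed.
Let t0 : 0 <= t. Proof. by rewrite mulr_ge0. Qed.
Let e0 : 0 < e. Proof. by rewrite invr_gt0 mulr_gt0// ltr_wpDl. Qed.

Let small (p : V) : `|p| < e -> t * `|p| <= 2^-1.
Proof.
move=> pe; apply: (@le_trans _ _ ((t + 1) * e)).
  by rewrite ler_pM// ?lerDl// ltW.
by rewrite /e invfM mulrCA divff ?mulr1// gt_eqF// ltr_wpDl.
Qed.

Let K0_bound (v w : 'cV[R]_N) : K0 *m v = w -> `|v| <= a * `|w|.
Proof. by move=> <-; rewrite -{1}[v]mul1mx -K0iK -mulmxA mx_norm_mul. Qed.

Let E_bound (p : V) (v : 'cV_N) : `|E p *m v| <= N%:R * `|p| * `|v|.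
Proof.
apply: le_trans (mx_norm_mul _ _) _.
by rewrite ler_wpM2r// ler_wpM2l.
Qed.

(** A kernel vector [v] satisfies K0 v = - E(p) v, hence |v| <= |v| / 2. *)
Lemma perturbed_unit : exists2 e, 0 < e & forall p, `|p| < e -> K0 + E p \in unitmx.
Proof.
exists e => // p pe; apply: inj_unitmx => v.
rewrite mulmxDl => /eqP; rewrite addr_eq0 => /eqP/K0_bound; rewrite normrN => h.
have h2 : `|v| <= t * `|p| * `|v|.
  have -> : t * `|p| * `|v| = a * (N%:R * `|p| * `|v|) by rewrite /t; ring.
  exact: le_trans h (ler_wpM2l a0 (E_bound p v)).
apply/eqP; rewrite -normr_eq0; apply/eqP.
have := small pe; have := normr_ge0 v; nra.
Qed.

Lemma perturbed_solution : exists C e, 0 < e /\ forall p z, `|p| < e ->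
  (K0 + E p) *m z = c0 + c p ->
  `|z - z0 - K0i *m (c p - E p *m z0)| <= C * `|p| ^+ 2.
Proof.
exists (2 * t * a * b), e; split=> // p z pe hz.
set q := c p - E p *m z0; set h := z - z0.
have Kh : K0 *m h = q - E p *m h.
  rewrite /h /q !mulmxBr Kz0; apply/eqP; rewrite -subr_eq0; apply/eqP.
  move/eqP: hz; rewrite mulmxDl -subr_eq0 => /eqP <-.
  by rewrite !opprD !opprK !addrA; apply/matrixP => i j; rewrite !mxE; ring.
have hq : `|q| <= b * `|p|.
  apply: le_trans (ler_normB _ _) _; rewrite /b mulrDl mul1r lerD//.
  by apply: le_trans (E_bound _ _) _; rewrite -!mulrA ler_wpM2l// mulrC.
(* The term t |p| |h| is at most |h| / 2 and is absorbed into the left-hand side, so [h] is O(p). *)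
have hh : `|h| <= 2 * a * b * `|p|.
  have h1 : `|h| <= a * (b * `|p|) + t * `|p| * `|h|.
    have -> : a * (b * `|p|) + t * `|p| * `|h| =
        a * (b * `|p| + N%:R * `|p| * `|h|) by rewrite /t; ring.
    apply: le_trans (K0_bound Kh) (ler_wpM2l a0 _).
    by apply: le_trans (ler_normB _ _) _; rewrite lerD// E_bound.
  have := small pe; have := normr_ge0 h; nra.
(* The remainder is exactly - K0i E(p) h, a product of two O(p) factors. *)
have -> : h - K0i *m q = - (K0i *m (E p *m h)).
  have := congr1 (mulmx K0i) Kh; rewrite mulmxA K0iK mul1mx mulmxBr => {1}->.
  by rewrite addrAC subrr sub0r.
rewrite normrN; apply: le_trans (mx_norm_mul _ _) _.
rewrite -/a; apply: le_trans (ler_wpM2l a0 (E_bound _ _)) _.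
apply: le_trans (_ : a * (N%:R * `|p| * (2 * a * b * `|p|)) <= _).
  by rewrite ler_wpM2l// ler_wpM2l// mulr_ge0.
by rewrite le_eqVlt; apply/orP; left; apply/eqP; rewrite /t; ring.
Qed.

End Perturbation.

(** * The spectral norm and maxima of ratios *)

Section SpectralNorm.
Local Open Scope classical_set_scope.
Variable R : realType.

Lemma continuous_bigsum (T : topologicalType) I (r : seq I) (f : I -> T -> R) :
  (forall i, continuous (f i)) -> continuous (fun x => \sum_(i <- r) f i x).
Proof.
move=> cf; elim: r => [|i r IH].
  by under eq_fun do rewrite big_nil; exact: cst_continuous.
under eq_fun do rewrite big_cons.
by move=> x; apply: continuousD; [exact: cf|exact: IH].
Qed.

Lemma continuous_quadratic_form k (M : 'M[R]_k) :
  continuous (fun u : 'rV[R]_k => frob u (u *m M)).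
Proof.
have cM i j : continuous (fun u : 'rV[R]_k => (u *m M) i j).
  under eq_fun do rewrite mxE.
  apply: continuous_bigsum => l v.
  by apply: continuousM; [exact: coord_continuous|exact: cst_continuous].
under eq_fun do rewrite frobE.
apply: continuous_bigsum => i; apply: continuous_bigsum => j u.
by apply: continuousM; [exact: coord_continuous|exact: cM].
Qed.

Lemma unit_ball_compact k : compact [set u : 'rV[R]_k | frob u u <= 1].
Proof.
apply: bounded_closed_compact.
  exists 1; split=> // c c1 u /= u1; apply: le_trans (ltW c1).
  apply: mx_norm_le => // i j; rewrite -(expr_le1 (_ : 0 < 2)%N)//.
  rewrite real_normK ?num_real//; apply: le_trans u1; rewrite frobE.
  rewrite (bigD1 i)//= (bigD1 j)//= -expr2 -addrA lerDl addr_ge0//.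
    by apply: sumr_ge0 => l _; rewrite -expr2 sqr_ge0.
  by apply: sumr_ge0 => l _; apply: sumr_ge0 => q _; rewrite -expr2 sqr_ge0.
have -> : [set u : 'rV[R]_k | frob u u <= 1] =
    (fun u : 'rV[R]_k => frob u (u *m 1%:M)) @^-1` [set x | x <= 1].
  by apply/seteqP; split=> u /=; rewrite mulmx1.
apply: closed_comp => [u _|]; last exact: closed_le.
exact: continuous_quadratic_form.
Qed.

(** |C u|^2 is the quadratic form of [C^T C], continuous on the compact unit ball. Compactness is
    used on row vectors, hence the transposes. *)
Lemma spectral_norm_attained m k (C : 'M[R]_(m, k)) :
  exists v : 'cV[R]_k, [/\ normF v <= 1, normF (C *m v) = spectral_norm C &
    forall u : 'cV[R]_k, normF u <= 1 -> normF (C *m u) <= spectral_norm C].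
Proof.
have cq := @continuous_quadratic_form _ (C^T *m C).
have [|w] := compact_EVT_max _ (@unit_ball_compact k) (continuous_subspaceT cq).
  by exists 0; rewrite /= /frob mulmx0 mxtrace0.
rewrite inE /= => w1 wmax.
have le1 l (u : 'cV[R]_l) : (normF u <= 1) = (frob u u <= 1).
  by rewrite -normF_sqr expr_le1// normF_ge0.
have nq (u : 'cV[R]_k) : normF (C *m u) = Num.sqrt (frob u^T (u^T *m (C^T *m C))).
  by rewrite normFE frob_mull frob_tr trmx_mul trmx_mul !trmxK mulmxA.
have wC (u : 'cV[R]_k) : normF u <= 1 -> normF (C *m u) <= normF (C *m w^T).
  rewrite le1 !nq => u1; apply: ler_wsqrtr; rewrite trmxK; apply: wmax.
  by rewrite inE /= frob_tr trmxK.
have w1' : normF w^T <= 1 by rewrite le1 frob_tr trmxK.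
have -> : spectral_norm C = normF (C *m w^T).
  apply/eqP; rewrite eq_le; apply/andP; split.
    apply: ge_sup => [|_ [u /= u1 <-]]; last exact: wC.
    by exists (normF (C *m w^T)), w^T.
  apply: ub_le_sup; last by exists w^T.
  by exists (normF (C *m w^T)) => _ [u /= u1 <-]; exact: wC.
by exists w^T.
Qed.

Lemma spectral_norm_ge0 m k (C : 'M[R]_(m, k)) : 0 <= spectral_norm C.
Proof. by have [v [_ <- _]] := spectral_norm_attained C; exact: normF_ge0. Qed.

Lemma spectral_norm_bound m k (C : 'M[R]_(m, k)) (u : 'cV[R]_k) :
  normF (C *m u) <= spectral_norm C * normF u.
Proof.
have [v [_ _ bd]] := spectral_norm_attained C.
have [/normF0_eq0 ->|u0] := eqVneq (normF u) 0.
  by rewrite mulmx0 !normF0 mulr0.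
have up : 0 < normF u by rewrite lt_neqAle eq_sym u0 normF_ge0.
rewrite -ler_pdivrMr//.
have : normF (C *m ((normF u)^-1 *: u)) <= spectral_norm C.
  by apply: bd; rewrite normFZ ger0_norm ?invr_ge0 ?normF_ge0// mulVf.
rewrite -scalemxAr normFZ ger0_norm ?invr_ge0 ?normF_ge0//.
by rewrite mulrC.
Qed.

Lemma maximum_eq (S : set R) (v : R) : S v -> ubound S v -> maximum S = v.
Proof.
move=> Sv ubv; have [Sw ubw] :
    [set v | S v /\ ubound S v] (maximum S) by apply: (@xgetPex _ 0); exists v.
by apply/eqP; rewrite eq_le ubv//= ubw.
Qed.

(** [S] may be empty, which happens when the data space is trivial; the default value of [maximum]
    then agrees with that of the set {0}. *)
Lemma maximum_sub0 (S : set R) : S `<=` [set 0] -> maximum S = 0.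
Proof.
move=> S0; rewrite /maximum; case: xgetP => // v _ [Sv _].
exact: S0.
Qed.

(* This is [||T||^2 = ||T T^*||], where [Ts] is the adjoint of [T] for the inner
   product [ip]; only [T Ts] has to act on a finite-dimensional space. *)
Lemma max_ratio_adjoint (V : lmodType R) (ip : V -> V -> R) k (C : 'M[R]_k)
    (T : V -> 'cV[R]_k) (Ts : 'cV[R]_k -> V) :
  (forall a u v w, ip (a *: u + v) w = a * ip u w + ip v w) ->
  (forall u v, ip u v = ip v u) -> (forall u, 0 <= ip u u) ->
  (forall p u, frob (T p) u = ip p (Ts u)) ->
  (forall u, T (Ts u) = C *m u) ->
  maximum [set normF (T p) / Num.sqrt (ip p p) | p in [set p | p != 0]] =
  Num.sqrt (spectral_norm C).
Proof.
move=> lin sym pos adj TTs.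
set sg := spectral_norm C; have sg0 : 0 <= sg by exact: spectral_norm_ge0.
have ipTs u : ip (Ts u) (Ts u) <= sg * normF u ^+ 2.
  rewrite -adj TTs; apply: le_trans (frob_le_normF _ _) _.
  by rewrite expr2 mulrA ler_wpM2r ?normF_ge0// spectral_norm_bound.
have ub p : normF (T p) <= Num.sqrt sg * Num.sqrt (ip p p).
  have [->|Tp0] := eqVneq (normF (T p)) 0; first by rewrite mulr_ge0 ?sqrtr_ge0.
  have Tp : 0 < normF (T p) by rewrite lt_neqAle eq_sym Tp0 normF_ge0.
  rewrite -(@ler_pXn2r _ 2)// ?nnegrE ?mulr_ge0 ?sqrtr_ge0 ?normF_ge0//.
  rewrite exprMn (sqr_sqrtr sg0) (sqr_sqrtr (pos p)).
  (* Since <p, Ts (T p)> = |T p|^2, this bounds |T p|^4 by ip p p times sg |T p|^2. *)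
  have := cauchy_schwarz lin sym pos p (Ts (T p)).
  rewrite -adj -normF_sqr => h.
  have : (normF (T p) ^+ 2) ^+ 2 <= sg * ip p p * normF (T p) ^+ 2.
    by apply: le_trans h _; rewrite -mulrA mulrCA ler_wpM2l.
  by rewrite (expr2 (normF _ ^+ 2)) ler_pM2r ?exprn_gt0.
(* [T] is not assumed linear; the adjoint identity alone gives T 0 = 0, so the maximiser [Ts v]
   below is nonzero. *)
have T0 : T 0 = 0.
  apply: frob_eq0; rewrite adj; have := lin (-1) 0 0 (Ts (T 0)).
  by rewrite scaleN1r oppr0 addr0 mulN1r addNr.
have [sg00|sgn0] := eqVneq sg 0.
  rewrite sg00 sqrtr0; apply: maximum_sub0 => _ [p _ <-] /=.
  have := ub p; rewrite sg00 sqrtr0 mul0r => Tp.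
  by have /eqP -> : normF (T p) == 0; rewrite ?mul0r// eq_le Tp normF_ge0.
have sgp : 0 < Num.sqrt sg by rewrite sqrtr_gt0 lt_neqAle eq_sym sgn0.
apply: maximum_eq => [|_ [p _ <-]]; last first.
  have [->|p0] := eqVneq (Num.sqrt (ip p p)) 0.
    by rewrite invr0 mulr0 sqrtr_ge0.
  by rewrite ler_pdivrMr ?ub// lt_neqAle eq_sym p0 sqrtr_ge0.
have [v [v1 Cv _]] := spectral_norm_attained C.
have TTv : normF (T (Ts v)) = sg by rewrite TTs.
exists (Ts v) => /=.
  apply/eqP => Tsv; move: TTv; rewrite Tsv T0 normF0 => /esym/eqP.
  by rewrite (negbTE sgn0).
have ipv : 0 < Num.sqrt (ip (Ts v) (Ts v)).
  rewrite -(pmulr_rgt0 _ sgp); apply: lt_le_trans (ub _).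
  by rewrite TTv lt_neqAle eq_sym sgn0.
(* The ratio at [Ts v] is at most sqrt(sg) by [ub], and at least that because ip (Ts v) (Ts v) <=
   sg. *)
rewrite TTv; apply/eqP; rewrite eq_le; apply/andP; split.
  by rewrite ler_pdivrMr// -{1}TTv.
rewrite ler_pdivlMr// -[leRHS](sqr_sqrtr sg0) expr2 ler_pM2l//.
apply: ler_wsqrtr; apply: le_trans (ipTs v) _.
by rewrite -[leRHS]mulr1 ler_wpM2l// expr_le1 ?normF_ge0.
Qed.

End SpectralNorm.

(** * Derivative of the solution map *)

Section Augmented.
Local Open Scope classical_set_scope.
Variables (R : realType) (m n s : nat).
Implicit Types (A dA : 'M[R]_(m, n)) (B dB : 'M[R]_(s, n)).

(** The data-dependent part of the augmented matrix. Being linear in [(A, B)], its value at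
    [(dA, dB)] is the perturbation of that matrix. *)
Definition aug_coupling A B : 'M[R]_(m + s + n) :=
  block_mx 0 (col_mx A B) (row_mx A^T B^T) 0.

(* The optimality conditions [r + A x = b], [B x = d], [A^T r + B^T l = 0] as one
   square system in [(r, l, x)]; unlike the normal equations it is affine in the
   data, so that the perturbation estimate has no further quadratic terms. *)
Definition aug_mx A B : 'M[R]_(m + s + n) :=
  block_mx (block_mx 1%:M 0 0 0) 0 0 0 + aug_coupling A B.

Lemma aug_coupling_mul p A B (r : 'M[R]_(m, p)) (l : 'M[R]_(s, p)) (x : 'M[R]_(n, p)) :
  aug_coupling A B *m col_mx (col_mx r l) x =
  col_mx (col_mx (A *m x) (B *m x)) (A^T *m r + B^T *m l).
Proof.
rewrite /aug_coupling mul_block_col !mul0mx add0r addr0 mul_col_mx.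
by rewrite mul_row_col.
Qed.

Lemma aug_mx_mul p A B (r : 'M[R]_(m, p)) (l : 'M[R]_(s, p)) (x : 'M[R]_(n, p)) :
  aug_mx A B *m col_mx (col_mx r l) x =
  col_mx (col_mx (r + A *m x) (B *m x)) (A^T *m r + B^T *m l).
Proof.
rewrite /aug_mx mulmxDl aug_coupling_mul !mul_block_col !mul0mx mul1mx !addr0.
by rewrite !add_col_mx !add0r.
Qed.

Lemma aug_coupling_lin a A B dA dB :
  aug_coupling (a *: dA + A) (a *: dB + B) =
  a *: aug_coupling dA dB + aug_coupling A B.
Proof.
rewrite /aug_coupling !linearP /= -add_col_mx -add_row_mx -scale_col_mx.
by rewrite -scale_row_mx scale_block_mx add_block_mx !scaler0 !addr0.
Qed.

Lemma aug_mxD A B dA dB :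
  aug_mx (dA + A) (dB + B) = aug_mx A B + aug_coupling dA dB.
Proof.
rewrite /aug_mx -addrA -[dA]scale1r -[dB]scale1r aug_coupling_lin !scale1r.
by rewrite [aug_coupling dA dB + _]addrC.
Qed.

Lemma aug_coupling_norm A B c :
  `|A| <= c -> `|B| <= c -> `|aug_coupling A B| <= c.
Proof.
move=> Ac Bc; have c0 : 0 <= c by exact: le_trans Ac.
apply: mx_norm_col; apply: mx_norm_row; rewrite ?normr0//.
- exact: mx_norm_col.
- apply: mx_norm_row; first exact: le_trans (mx_norm_tr _) Ac.
  exact: le_trans (mx_norm_tr _) Bc.
Qed.

(** [A^T r] lies in the range of [B^T], so [r] is orthogonal to A (x - y) for every feasible [y].
    Pythagoras gives minimality, and injectivity on null(B) gives uniqueness. *)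
Lemma lse_sol_kkt A B b d (r : 'cV[R]_m) (l : 'cV[R]_s) (x : 'cV[R]_n) :
  (forall v : 'cV[R]_n, A *m v = 0 -> B *m v = 0 -> v = 0) ->
  r + A *m x = b -> B *m x = d -> A^T *m r + B^T *m l = 0 ->
  lse_sol A B b d = x.
Proof.
move=> inj rx Bx kkt.
have pyth y : B *m y = d ->
    normF (b - A *m y) ^+ 2 =
    normF (b - A *m x) ^+ 2 + normF (A *m (x - y)) ^+ 2.
  move=> By; rewrite !normF_sqr.
  have -> : b - A *m x = r by rewrite -rx addrK.
  have -> : b - A *m y = r + A *m (x - y) by rewrite -rx mulmxBr addrA.
  have cross : frob r (A *m (x - y)) = 0.
    rewrite frobC frob_mull.
    have -> : A^T *m r = - (B^T *m l) by apply/eqP; rewrite -addr_eq0 kkt.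
    by rewrite frobNr -frob_mull mulmxBr Bx By subrr /frob trmx0 mul0mx mxtrace0 oppr0.
  by rewrite !frobDl !frobDr (frobC _ r) cross addr0 add0r.
have sol : is_lse_solution A B b d x.
  split=> // y By; rewrite -(@ler_pXn2r _ 2)// ?nnegrE ?normF_ge0//.
  by rewrite (pyth y By) lerDl sqr_ge0.
have [By miny] : is_lse_solution A B b d (lse_sol A B b d).
  by apply: (@xgetPex _ 0 [set x | is_lse_solution A B b d x]); exists x.
set y := lse_sol A B b d in By miny *.
have Axy : A *m (x - y) = 0.
  apply: normF0_eq0; apply/eqP; rewrite -sqrf_eq0 eq_le sqr_ge0 andbT.
  have := miny x Bx; rewrite -(@ler_pXn2r _ 2)// ?nnegrE ?normF_ge0//.
  by rewrite (pyth y By) gerDl.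
have : x - y = 0 by apply: inj => //; rewrite mulmxBr Bx By subrr.
by move/eqP; rewrite subr_eq0 => /eqP.
Qed.

(** Transfers the null-space condition to perturbed data, where only invertibility of the augmented
    matrix is known. *)
Lemma aug_unit_inj A B : aug_mx A B \in unitmx ->
  forall v : 'cV[R]_n, A *m v = 0 -> B *m v = 0 -> v = 0.
Proof.
move=> uK v Av Bv.
have : aug_mx A B *m col_mx (col_mx 0 0) v = 0.
  by rewrite aug_mx_mul Av Bv !mulmx0 !addr0 !col_mx0.
move/(congr1 (mulmx (invmx (aug_mx A B)))); rewrite mulKmx// mulmx0.
by move/(congr1 (@dsubmx _ _ _ _)); rewrite col_mxKd linear0.
Qed.

Lemma lse_sol_aug A B b d (z : 'cV[R]_(m + s + n)) :
  aug_mx A B \in unitmx ->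
  aug_mx A B *m z = col_mx (col_mx b d) 0 -> lse_sol A B b d = dsubmx z.
Proof.
move=> uK; rewrite -{1}[z]vsubmxK -{1}[usubmx z]vsubmxK aug_mx_mul.
move=> /eq_col_mx[/eq_col_mx[e1 e2] e3].
exact: lse_sol_kkt (aug_unit_inj uK) e1 e2 e3.
Qed.

End Augmented.

Section Derivative.
Local Open Scope classical_set_scope.
Variables (R : realType) (m n s : nat).
Variables (A : 'M[R]_(m, n)) (B : 'M[R]_(s, n)).
Hypothesis hB : \rank B = s.
Hypothesis hAB : forall v : 'cV[R]_n, A *m v = 0 -> B *m v = 0 -> v = 0.

(* [G] and [BA] stand for [((AP)^T AP)^+] and [B_A^+]; keeping them abstract
   prevents associativity rewrites from unfolding [wpinv]. *)
Variables (G : 'M[R]_n) (BA : 'M[R]_(n, s)).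
Let P := kerproj B.
Let K := aug_mx A B.
Hypotheses (GT : G^T = G) (BG : B *m G = 0) (BBA : B *m BA = 1%:M).
Hypotheses (GP : G *m A^T *m A *m P = P) (PBA : P *m A^T *m A *m BA = 0).

Let GB : G *m B^T = 0.
Proof. by apply: trmx_inj; rewrite trmx_mul trmxK GT BG trmx0. Qed.

(** In the homogeneous system |r|^2 = - <A x, r> = <B x, l> = 0; then A x = 0 and B x = 0 give x =
    0, and full row rank of [B] gives l = 0. *)
Lemma aug_unit : K \in unitmx.
Proof.
apply: inj_unitmx => z; rewrite -[z]vsubmxK -[usubmx z]vsubmxK aug_mx_mul.
set r := usubmx (usubmx z); set l := dsubmx (usubmx z); set x := dsubmx z.
rewrite -[0]vsubmxK -[usubmx 0]vsubmxK !linear0.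
move=> /eq_col_mx[/eq_col_mx[e1 e2] e3].
have r0 : r = 0.
  apply: frob_eq0.
  have er : r = - (A *m x) by apply/eqP; rewrite -addr_eq0 e1.
  rewrite {2}er frobNr frobC frob_mull.
  have -> : A^T *m r = - (B^T *m l) by apply/eqP; rewrite -addr_eq0 e3.
  by rewrite frobNr -frob_mull e2 opprK /frob trmx0 mul0mx mxtrace0.
have x0 : x = 0 by apply: hAB => //; rewrite -e1 r0 add0r.
have l0 : l = 0.
  apply: trmx_inj; apply: (row_free_inj (_ : row_free B)).
    by rewrite /row_free hB.
  apply: trmx_inj; rewrite trmx0 mul0mx trmx0 trmx_mul trmxK.
  by rewrite -e3 r0 mulmx0 add0r.
by rewrite r0 l0 x0 !col_mx0.
Qed.

(** The last block row of the inverse is (G A^T, BA, -G). It is checked by completing [y] to a full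
    solution of the system. *)
Lemma aug_inv_dsub p (f1 : 'M[R]_(m, p)) (f2 : 'M[R]_(s, p)) (f3 : 'M[R]_(n, p)) :
  dsubmx (invmx K *m col_mx (col_mx f1 f2) f3) =
  G *m (A^T *m f1 - f3) + BA *m f2.
Proof.
set y := RHS; set y1 := f1 - A *m y.
set l := (mpinv B)^T *m (f3 - A^T *m y1).
have By : B *m y = f2.
  by rewrite mulmxDr !mulmxA BG BBA mul0mx add0r mul1mx.
(* The third equation is solvable for the multiplier exactly when its residue is killed by [P]. *)
have Py : P *m (f3 - A^T *m y1) = 0.
  have PAG : P *m A^T *m A *m G = P.
    have := congr1 trmx GP.
    by rewrite !trmx_mul !trmxK kerproj_tr GT !mulmxA.
  have PAy : P *m A^T *m A *m y = P *m (A^T *m f1 - f3).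
    by rewrite [LHS]mulmxDr !mulmxA PAG PBA mul0mx addr0.
  by rewrite !mulmxBr !mulmxA PAy mulmxBr mulmxA subKr subrr.
have -> : col_mx (col_mx f1 f2) f3 = K *m col_mx (col_mx y1 l) y.
  rewrite aug_mx_mul By subrK /l -(kerproj_eq0 Py) addrC subrK.
  by [].
by rewrite mulKmx ?aug_unit// col_mxKd.
Qed.

Variables (b : 'cV[R]_m) (d : 'cV[R]_s).
Let x := lse_sol A B b d.
Let r := b - A *m x.
Let l := - (BA^T *m A^T *m r).

(** Multiplying the third block equation by [BA^T] isolates the multiplier, as BA^T B^T = I;
    multiplying it by [G] leaves G A^T r = 0, as G B^T = 0. *)
Lemma lse_base :
  K *m col_mx (col_mx r l) x = col_mx (col_mx b d) 0 /\ G *m A^T *m r = 0.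
Proof.
set z := invmx K *m col_mx (col_mx b d) 0.
have Kz : K *m z = col_mx (col_mx b d) 0 by rewrite mulKVmx ?aug_unit.
have xE : x = dsubmx z by exact: lse_sol_aug aug_unit Kz.
move: (Kz); rewrite -{1}[z]vsubmxK -{1}[usubmx z]vsubmxK aug_mx_mul -xE.
move=> /eq_col_mx[/eq_col_mx[e1 e2] e3].
have rE : r = usubmx (usubmx z) by rewrite /r -e1 addrK.
rewrite -rE in e1 e3.
have lE : l = dsubmx (usubmx z).
  have := congr1 (mulmx BA^T) e3; rewrite mulmxDr !mulmxA -[BA^T *m B^T]trmx_mul BBA.
  rewrite trmx1 mul1mx mulmx0 addrC => /eqP; rewrite addr_eq0 => /eqP ->.
  by [].
rewrite -lE in e3; split=> //.
  by rewrite aug_mx_mul e1 e2 e3.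
have -> : G *m A^T *m r = G *m (A^T *m r + B^T *m l).
  by rewrite mulmxDr !mulmxA GB mul0mx addr0.
by rewrite e3 mulmx0.
Qed.

Variables (k : nat) (L : 'M[R]_(n, k)).

Lemma lse_map_diff :
  'd (@lse_map R m n s k L) (A, B, b, d) = (fun p => let: (dA, dB, db, dd) := p in
    L^T *m (G *m (A^T *m (db - dA *m x) + dA^T *m r + dB^T *m l)
            + BA *m (dd - dB *m x)))
  :> ('M[R]_(m, n) * 'M[R]_(s, n) * 'cV[R]_m * 'cV[R]_s -> 'cV[R]_k).
Proof.
pose V := ('M[R]_(m, n) * 'M[R]_(s, n) * 'cV[R]_m * 'cV[R]_s)%type.
pose E (p : V) := aug_coupling p.1.1.1 p.1.1.2.
pose c (p : V) : 'cV[R]_(m + s + n) := col_mx (col_mx p.1.2 p.2) 0.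
pose z0 := col_mx (col_mx r l) x.
pose df (p : V) := L^T *m dsubmx (invmx K *m (c p - E p *m z0)).
have [Kz0 _] := lse_base.
have KiK : invmx K *m K = 1%:M by rewrite mulVmx ?aug_unit.
have bV (p : V) : [/\ `|p.1.1.1| <= `|p|, `|p.1.1.2| <= `|p|,
    `|p.1.2| <= `|p| & `|p.2| <= `|p|].
  case: p => [[[dA dB] db] dd].
  by rewrite !prod_normE /= !le_max !lexx !orbT.
have bE p : `|E p| <= `|p|.
  by have [? ? _ _] := bV p; exact: aug_coupling_norm.
have bc p : `|c p| <= `|p|.
  have [_ _ ? ?] := bV p.
  by apply: mx_norm_col; rewrite ?normr0//; exact: mx_norm_col.
have -> : (fun p : V => let: (dA, dB, db, dd) := p in
    L^T *m (G *m (A^T *m (db - dA *m x) + dA^T *m r + dB^T *m l)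
            + BA *m (dd - dB *m x))) = df.
  apply/funext => -[[[dA dB] db] dd]; rewrite /df /c /E /= aug_coupling_mul.
  rewrite !opp_col_mx !add_col_mx sub0r aug_inv_dsub opprK.
  by rewrite !addrA.
have [e1 e10 uK] := perturbed_unit KiK bE.
have [C [e2 [e20 rem]]] := perturbed_solution KiK Kz0 bE bc.
pose N : R := (m + s + n)%:R.
(* Below [e1] the perturbed matrix is invertible, so [lse_map] can be read off the perturbed system;
   below [e2] the remainder bound holds. *)
apply: (@diff_quadratic_remainder _ _ _ _ _ _
  (n%:R * `|L^T| * (N * `|invmx K| * (1 + N * `|z0|)))
  (n%:R * `|L^T| * C) (Num.min e1 e2)).
- move=> a p q; rewrite /df /E /c /=.
  rewrite aug_coupling_lin -[0 in LHS]addr0 -[0 in X in col_mx _ (X + _)](scaler0 _ a).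
  rewrite -!add_col_mx -!scale_col_mx mulmxDl -scalemxAl opprD addrACA -scalerBr.
  by rewrite mulmxDr -scalemxAr linearP /= mulmxDr -scalemxAr.
- move=> p; apply: le_trans (mx_norm_mul _ _) _.
  rewrite -[leRHS]mulrA ler_wpM2l ?mulr_ge0//; apply: le_trans (mx_norm_dsub _) _.
  apply: le_trans (mx_norm_mul _ _) _.
  rewrite -[leRHS]mulrA ler_wpM2l ?mulr_ge0//; apply: le_trans (ler_normB _ _) _.
  rewrite mulrDl mul1r lerD//; apply: le_trans (mx_norm_mul _ _) _.
  by rewrite mulrAC ler_wpM2l ?mulr_ge0// ler_wpM2l.
- by rewrite lt_min e10.
- move=> p; rewrite lt_min => /andP[pe1 pe2].
  have uKp := uK p pe1.
  pose z := invmx (K + E p) *m (col_mx (col_mx b d) 0 + c p).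
  have Kz : (K + E p) *m z = col_mx (col_mx b d) 0 + c p by rewrite mulKVmx.
  have := rem p z pe2 Kz.
  have -> : lse_map L (p + (A, B, b, d)) = L^T *m dsubmx z.
    move: uKp Kz; rewrite -aug_mxD; case: p {pe1 pe2} @z => [[[dA dB] db] dd] /=.
    rewrite /c /= !add_col_mx addr0 (addrC b) (addrC d) => uKp Kz.
    by rewrite (lse_sol_aug uKp Kz).
  have -> : lse_map L (A, B, b, d) = L^T *m dsubmx z0 by rewrite /lse_map col_mxKd.
  move=> h; rewrite /df -!mulmxBr -!linearB /=.
  apply: le_trans (mx_norm_mul _ _) _; rewrite -[leRHS]mulrA ler_wpM2l ?mulr_ge0//.
  exact: le_trans (mx_norm_dsub _) h.
Qed.

End Derivative.

(** * The adjoint of the derivative *)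

Section Adjoint.
Variables (R : realType) (m n s k : nat).
Variables (A : 'M[R]_(m, n)) (G : 'M[R]_n) (BA : 'M[R]_(n, s)).
Variables (L : 'M[R]_(n, k)) (r : 'cV[R]_m) (x : 'cV[R]_n).
Variables (aA aB ab ad : R).
Hypotheses (haA : 0 < aA) (haB : 0 < aB) (hab : 0 < ab) (had : 0 < ad).
Hypotheses (GT : G^T = G) (GAG : G *m A^T *m A *m G = G).
Hypothesis GAr : G *m A^T *m r = 0.

Let V := ('M[R]_(m, n) * 'M[R]_(s, n) * 'cV[R]_m * 'cV[R]_s)%type.
Let l := - (BA^T *m A^T *m r).

Definition weighted_ip (p q : V) : R :=
  aA ^+ 2 * frob p.1.1.1 q.1.1.1 + aB ^+ 2 * frob p.1.1.2 q.1.1.2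
  + ab ^+ 2 * frob p.1.2 q.1.2 + ad ^+ 2 * frob p.2 q.2.

Lemma weighted_ip_lin a u v w :
  weighted_ip (a *: u + v) w = a * weighted_ip u w + weighted_ip v w.
Proof. by rewrite /weighted_ip /= !frob_linl; ring. Qed.

Lemma weighted_ip_sym u v : weighted_ip u v = weighted_ip v u.
Proof.
by rewrite /weighted_ip (frobC u.2) (frobC u.1.2) (frobC u.1.1.2) (frobC u.1.1.1).
Qed.

Lemma weighted_ip_ge0 u : 0 <= weighted_ip u u.
Proof. by rewrite !addr_ge0// mulr_ge0 ?sqr_ge0 ?frob_ge0. Qed.

Lemma weighted_normFE p : weighted_normF aA aB ab ad p = Num.sqrt (weighted_ip p p).
Proof.
by case: p => [[[dA dB] db] dd]; rewrite /weighted_normF !normF_sqr.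
Qed.

Definition lse_deriv (p : V) : 'cV[R]_k := let: (dA, dB, db, dd) := p in
  L^T *m (G *m (A^T *m (db - dA *m x) + dA^T *m r + dB^T *m l)
          + BA *m (dd - dB *m x)).

(** Inverse squared weights compensate those of [weighted_ip]; the outer products arise from <X^T y,
    g> = <X, y g^T>. *)
Definition lse_deriv_adj (u : 'cV[R]_k) : V :=
  let g := G *m (L *m u) in
  let h := BA^T *m (L *m u) in
  ((aA ^+ 2)^-1 *: (r *m g^T - A *m g *m x^T),
   (aB ^+ 2)^-1 *: (l *m g^T - h *m x^T),
   (ab ^+ 2)^-1 *: (A *m g), (ad ^+ 2)^-1 *: h).

Lemma lse_deriv_adjP p u :
  frob (lse_deriv p) u = weighted_ip p (lse_deriv_adj u).
Proof.
case: p => [[[dA dB] db] dd]; rewrite /weighted_ip /= !frobZr.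
rewrite !mulVKf ?expf_neq0 ?gt_eqF// frob_mull trmxK.
set v := L *m u; rewrite frobDl !(frob_mull G) GT (frob_mull BA).
set g := G *m v; set h := BA^T *m v.
have tr_mul p (X : 'M[R]_(p, n)) (y : 'cV[R]_p) :
    frob (X^T *m y) g = frob X (y *m g^T).
  by rewrite frob_mulr frob_tr trmx_mul trmxK.
rewrite !frobDl (frob_mull A^T) trmxK !tr_mul !frobDl !frobNl !frob_mulr !frobDr !frobNr.
ring.
Qed.

Lemma mulmx_dot p q (w : 'cV[R]_p) (y z : 'cV[R]_q) :
  w *m (y^T *m z) = frob y z *: w.
Proof. by rewrite [y^T *m z]mx11_scalar mul_mx_scalar /frob trace_mx11. Qed.

Lemma outer_tr p q (y : 'cV[R]_p) (z : 'cV[R]_q) : (y *m z^T)^T = z *m y^T.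
Proof. by rewrite trmx_mul trmxK. Qed.

Definition lse_condmx : 'M[R]_k :=
  (normF r ^+ 2 / aA ^+ 2 + normF (r^T *m A *m BA) ^+ 2 / aB ^+ 2)
      *: (L^T *m (G *m G) *m L)
  + (normF x ^+ 2 / aA ^+ 2 + 1 / ab ^+ 2) *: (L^T *m G *m L)
  + (normF x ^+ 2 / aB ^+ 2 + 1 / ad ^+ 2) *: (L^T *m BA *m BA^T *m L)
  + (1 / aB ^+ 2) *: (L^T *m G *m x *m r^T *m A *m BA *m BA^T *m L)
  + (1 / aB ^+ 2) *: (L^T *m BA *m BA^T *m A^T *m r *m x^T *m G *m L).

Lemma lse_deriv_adj_mul u : lse_deriv (lse_deriv_adj u) = lse_condmx *m u.
Proof.
rewrite /lse_deriv /=; set v := L *m u; set g := G *m v; set h := BA^T *m v.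
have lT : l^T = - (r^T *m A *m BA).
  by rewrite /l linearN /= !trmx_mul !trmxK mulmxA.
have nl : normF (r^T *m A *m BA) ^+ 2 = frob l l.
  by rewrite normF_sqr -[l]trmxK frob_tr !trmxK lT frobNl frobNr opprK.
have GAg : G *m (A^T *m (A *m g)) = g by rewrite /g !mulmxA GAG.
have grA : frob (A *m g) r = 0.
  by rewrite frob_mull /g frob_mull GT mulmxA GAr /frob mulmx0 mxtrace0.
(* The part of dA along [r g^T] drops out because G A^T r = 0, and G A^T A g = g. *)
have e1 : G *m (A^T *m ((ab ^+ 2)^-1 *: (A *m g)
      - (aA ^+ 2)^-1 *: (r *m g^T - A *m g *m x^T) *m x)) =
    ((ab ^+ 2)^-1 + (aA ^+ 2)^-1 * frob x x) *: g.
  rewrite -scalemxAl mulmxBl -!mulmxA mulmx_dot mulmx_dot.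
  rewrite !(mulmxBr, mulmxDr, mulmxN) -!scalemxAr !mulmxBr -!scalemxAr.
  rewrite !(mulmxA G A^T r) GAr scaler0 GAg sub0r scalerN opprK scalerA.
  by rewrite -scalerDl.
(* The part of dA along [A g x^T] contributes a multiple of <A g, r> = 0. *)
have e2 : ((aA ^+ 2)^-1 *: (r *m g^T - A *m g *m x^T))^T *m r =
    ((aA ^+ 2)^-1 * frob r r) *: g.
  rewrite linearZ linearB /= !outer_tr -scalemxAl mulmxBl -!(mulmxA _ _^T).
  rewrite !mulmx_dot grA scale0r subr0 scalerA.
  by [].
have e3 : ((aB ^+ 2)^-1 *: (l *m g^T - h *m x^T))^T *m l =
    (aB ^+ 2)^-1 *: (frob l l *: g - frob h l *: x).
  by rewrite linearZ linearB /= !outer_tr -scalemxAl mulmxBl -!(mulmxA _ _^T) !mulmx_dot.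
have e4 : (aB ^+ 2)^-1 *: (l *m g^T - h *m x^T) *m x =
    (aB ^+ 2)^-1 *: (frob g x *: l - frob x x *: h).
  by rewrite -scalemxAl mulmxBl -!(mulmxA _ _^T) !mulmx_dot.
(* The last two terms of [C] come from the cross terms of dB, which survive. *)
have e5 : x *m (r^T *m (A *m (BA *m h))) = - frob l h *: x.
  by rewrite (mulmxA r^T) (mulmxA _ BA) -[r^T *m A *m BA]opprK -lT mulNmx mulmxN
             mulmx_dot scaleNr.
have e6 : BA *m (BA^T *m (A^T *m (r *m (x^T *m g)))) = - frob x g *: (BA *m l).
  by rewrite mulmx_dot -!scalemxAr (mulmxA BA^T) -[BA^T *m A^T *m r]opprK -/l
             mulmxN scalerN scaleNr.
rewrite !(mulmxDr G) e1 e2 e3 e4 /lse_condmx nl !normF_sqr !mulmxDl -!scalemxAl.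
rewrite -!mulmxA -/g -/h e5 e6.
rewrite (frobC h) (frobC g).
rewrite !(=^~ scalemxAr, mulmxBr, mulmxDr).
(* Both sides are now combinations of these five vectors, so only the scalar coefficients have to
   match. *)
move: (L^T *m (G *m g)) (L^T *m g) (L^T *m (BA *m h)) (L^T *m (G *m x))
  (L^T *m (BA *m l)) => w1 w2 w3 w4 w5.
by apply/matrixP => i j; rewrite !mxE; ring.
Qed.

End Adjoint.

Theorem theorem2p2 (R : realType) (m n s k : nat)
    (hn : (n <= m + s)%N) (hs : (s <= n)%N) (hk : (k <= n)%N)
    (A : 'M[R]_(m, n)) (B : 'M[R]_(s, n)) (b : 'cV[R]_m) (d : 'cV[R]_s)
    (hB : \rank B = s)
    (hAB : forall v : 'cV[R]_n, A *m v = 0 -> B *m v = 0 -> v = 0)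
    (L : 'M[R]_(n, k)) (aA aB ab ad : R)
    (haA : 0 < aA) (haB : 0 < aB) (hab : 0 < ab) (had : 0 < ad) :
  let x := lse_sol A B b d in
  let r := b - A *m x in
  let AP := A *m kerproj B in
  let G := mpinv (AP^T *m AP) in
  let BA := wpinv A B in
  let C :=
    (normF r ^+ 2 / aA ^+ 2 + normF (r^T *m A *m BA) ^+ 2 / aB ^+ 2)
      *: (L^T *m (G *m G) *m L)
    + (normF x ^+ 2 / aA ^+ 2 + 1 / ab ^+ 2) *: (L^T *m G *m L)
    + (normF x ^+ 2 / aB ^+ 2 + 1 / ad ^+ 2) *: (L^T *m BA *m BA^T *m L)
    + (1 / aB ^+ 2) *: (L^T *m G *m x *m r^T *m A *m BA *m BA^T *m L)
    + (1 / aB ^+ 2) *: (L^T *m BA *m BA^T *m A^T *m r *m x^T *m G *m L) in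
  kappa_lse L aA aB ab ad A B b d = Num.sqrt (spectral_norm C).
Proof.
move=> x r AP G BA C.
have GT : G^T = G by exact: projgram_tr.
have BG : B *m G = 0 by exact: mul_projgram.
have BBA : B *m BA = 1%:M by exact: mul_wpinv.
have GP : G *m A^T *m A *m kerproj B = kerproj B by exact: projgram_inv.
have PBA : kerproj B *m A^T *m A *m BA = 0 by exact: kerproj_gram_wpinv.
have GAG : G *m A^T *m A *m G = G by exact: projgram_gram.
have [_ GAr] := lse_base hB hAB GT BG BBA b d.
have CE : C = lse_condmx A G BA L r x aA aB ab ad by [].
rewrite CE /kappa_lse (lse_map_diff hB hAB GT BG BBA GP PBA).
rewrite -(max_ratio_adjoint (@weighted_ip_lin R m n s aA aB ab ad)
  (@weighted_ip_sym R m n s aA aB ab ad) (@weighted_ip_ge0 R m n s aA aB ab ad)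
  (lse_deriv_adjP A BA L r x haA haB hab had GT)
  (lse_deriv_adj_mul BA L x aA aB ab ad GT GAG GAr)).
congr maximum; apply/seteqP; split=> _ [p p0 <-]; exists p => //;
  by rewrite weighted_normFE; case: p p0 => [[[dA dB] db] dd].
Qed.
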